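(* Let $\mathcal{H}$ be an infinite-dimensional separable Hilbert space and $\mathcal{H}'$ a Hilbert space. Let $L:D(L)\subset\mathcal{H}\to\mathcal{H}$ be a self-adjoint operator whose domain $D(L)$, endowed with the graph norm, is compactly embedded in $\mathcal{H}$. Let $\{\varphi_k\}_{k=1}^\infty$ be an orthonormal basis of $\mathcal{H}$ consisting of eigenfunctions of $L$ with eigenvalues $\lambda_k\in\mathbb{R}$ ordered so that $|\lambda_1|\le|\lambda_2|\le\cdots$ (with $|\lambda_k|\to\infty$), and let $P_n:\mathcal{H}\to\mathcal{H}$ be the orthogonal projection onto $\operatorname{span}\{\varphi_k\}_{k=1}^n$. If $A:\mathcal{H}\to\mathcal{H}'$ is a bounded linear operator with $\operatorname{Range}(A^* )\subset D(L)$, then $LA^*$ is bounded. Moreover, for any $n\ge1$ satisfying $\lambda_{n+1}\ne0$, $$\|A-AP_n\|_{\mathcal{H}\to\mathcal{H}'}\le\frac{1}{|\lambda_{n+1}|}\|LA^*\|_{\mathcal{H}'\to\mathcal{H}}.$$ Equality for all such $n$ is achieved by the compact self-adjoint operator $A=L^\dagger:\mathcal{H}\to\mathcal{H}$ (with $\mathcal{H}'=\mathcal{H}$) defined by $$L^\dagger: f\mapsto\sum_{\substack{k=1\\ \lambda_k\ne0}}^\infty\frac{1}{\lambda_k}\varphi_k\langle\varphi_k,f\rangle_{\mathcal{H}}.$$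
   Context: $L$ is a densely defined, in general unbounded operator. The graph norm on $D(L)$ is $\|f\|_L^2=\|f\|_{\mathcal{H}}^2+\|Lf\|_{\mathcal{H}}^2$. Inner products are linear in the second argument. $\|\cdot\|_{\mathcal{H}\to\mathcal{H}'}$ denotes the induced operator norm. An eigenbasis as described always exists under these assumptions on $L$. *)

(* Defs.v *)
From HB Require Import structures.
From mathcomp Require Import all_boot all_order all_algebra.
From mathcomp Require Import complex.
From mathcomp Require Import all_classical all_reals all_analysis.

Set Implicit Arguments.
Unset Strict Implicit.
Unset Printing Implicit Defensive.

Import Order.TTheory GRing.Theory Num.Theory.
Import numFieldNormedType.Exports.

Local Open Scope classical_set_scope.
Local Open Scope ring_scope.

(* Hilbert spaces are taken over the reals or over the complex numbers; all
   definitions treat both cases uniformly. *)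
Variant scalar_kind := RealScalars | ComplexScalars.

Definition scalar_field (R : realType) (s : scalar_kind) : numFieldType :=
  match s with
  | RealScalars => (R : numFieldType)
  | ComplexScalars => (R[i] : numFieldType)
  end.

Definition conj_scalar (R : realType) (s : scalar_kind) :
    scalar_field R s -> scalar_field R s :=
  match s return scalar_field R s -> scalar_field R s with
  | RealScalars => fun x => x
  | ComplexScalars => fun z => conjc z
  end.

Definition re_scalar (R : realType) (s : scalar_kind) : scalar_field R s -> R :=
  match s return scalar_field R s -> R with
  | RealScalars => fun x => x
  | ComplexScalars => fun z => complex.Re z
  end.

Definition of_real (R : realType) (s : scalar_kind) : R -> scalar_field R s :=
  match s return R -> scalar_field R s with
  | RealScalars => fun x => x
  | ComplexScalars => fun x => real_complex R x
  end.

HB.mixin Record CompleteNormedModule_isHilbert (R : realType) (s : scalar_kind)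
    H of CompleteNormedModule (scalar_field R s) H := {
  inner : H -> H -> scalar_field R s;
  inner_linear : forall (x : H) (a : scalar_field R s) (y z : H),
    inner x (a *: y + z) = a * inner x y + inner x z;
  inner_conj : forall x y : H, inner y x = conj_scalar (inner x y);
  inner_norm : forall x : H, inner x x = `|x| ^+ 2
}.

#[short(type="hilbertType")]
HB.structure Definition Hilbert (R : realType) (s : scalar_kind) :=
  {H of CompleteNormedModule (scalar_field R s) H & CompleteNormedModule_isHilbert R s H}.

Section HilbertSpace.
Variables (R : realType) (s : scalar_kind).
Local Notation K := (scalar_field R s).

(* The library norm `|x| takes its values in the scalar field. *)
Definition rnorm (H : hilbertType R s) (x : H) : R := re_scalar `|x|.

Definition lin_span (H : hilbertType R s) (S : set H) : set H :=
  [set x | exists n (v : 'I_n -> H) (c : 'I_n -> K),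
     (forall i, S (v i)) /\ x = \sum_i c i *: v i].

Definition infinite_dimensional (H : hilbertType R s) : Prop :=
  ~ exists n (v : 'I_n -> H), lin_span (range v) = setT.

Definition separable_space (T : topologicalType) : Prop :=
  exists S : set T, countable S /\ dense S.

Definition orthonormal_seq (H : hilbertType R s) (phi : nat -> H) : Prop :=
  forall i j, inner (phi i) (phi j) = (i == j)%:R.

Definition orthonormal_basis (H : hilbertType R s) (phi : nat -> H) : Prop :=
  orthonormal_seq phi /\ closure (lin_span (range phi)) = setT.

(* Orthogonal projection onto V; well defined when V is a closed subspace, in
   particular when V is finite dimensional. *)
Definition orth_proj (H : hilbertType R s) (V : set H) (x : H) : H :=
  xget 0 [set p | V p /\ forall v, V v -> inner v (x - p) = 0].

(* An operator with domain D is a pair of D and a total function, of which only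
   the values on D are relevant. *)
Definition linear_on (H H' : hilbertType R s) (D : set H) (T : H -> H') : Prop :=
  D 0 /\ forall (a : K) x y, D x -> D y ->
    D (a *: x + y) /\ T (a *: x + y) = a *: T x + T y.

Definition adjoint_dom (H H' : hilbertType R s) (D : set H) (T : H -> H')
    : set H' :=
  [set y | exists z, forall x, D x -> inner y (T x) = inner z x].

(* For dense D, the vector z is unique; outside adjoint_dom D T the value of
   adjoint D T is the irrelevant default 0. *)
Definition adjoint (H H' : hilbertType R s) (D : set H) (T : H -> H') (y : H')
    : H :=
  xget 0 [set z | forall x, D x -> inner y (T x) = inner z x].

Definition self_adjoint (H : hilbertType R s) (D : set H) (T : H -> H) : Prop :=
  [/\ dense D, linear_on D T, adjoint_dom D T = D &
      forall y, D y -> adjoint D T y = T y].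

Definition bounded_operator (H H' : hilbertType R s) (T : H -> H') : Prop :=
  linear T /\ exists M : R, forall x, rnorm (T x) <= M * rnorm x.

(* Extended-real valued, so that an unbounded operator has norm +oo. *)
Definition opnorm (H H' : hilbertType R s) (T : H -> H') : \bar R :=
  ereal_sup [set (rnorm (T x))%:E | x in [set x | rnorm x <= 1]].

Definition graph_norm (H : hilbertType R s) (T : H -> H) (x : H) : R :=
  Num.sqrt (rnorm x ^+ 2 + rnorm (T x) ^+ 2).

(* T is compact on the space D normed by N *)
Definition compact_operator (H H' : hilbertType R s) (D : set H) (N : H -> R)
    (T : H -> H') : Prop :=
  forall B : set H, B `<=` D -> (exists M : R, forall x, B x -> N x <= M) ->
    precompact (T @` B).

Definition compactly_embedded (H : hilbertType R s) (D : set H) (T : H -> H)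
    : Prop :=
  compact_operator D (graph_norm T) (idfun : H -> H).

Definition dagger_term (H : hilbertType R s) (phi : nat -> H) (lam : nat -> R)
    (f : H) (k : nat) : H :=
  if lam k != 0 then (of_real s (lam k)^-1 * inner (phi k) f) *: phi k else 0.

Definition dagger (H : hilbertType R s) (phi : nat -> H) (lam : nat -> R)
    (f : H) : H :=
  lim (series (dagger_term phi lam f) @ \oo).

End HilbertSpace.

(* Main.v *)
Require Import Defs.
From HB Require Import structures.
From mathcomp Require Import all_boot all_order all_algebra.
From mathcomp Require Import complex.
From mathcomp Require Import all_classical all_reals all_analysis.
From mathcomp Require Import ring lra.
Import Order.TTheory GRing.Theory Num.Theory.
Import numFieldNormedType.Exports.
Local Open Scope classical_set_scope.
Local Open Scope ring_scope.

Set Implicit Arguments.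
Unset Strict Implicit.
Unset Printing Implicit Defensive.

(* In the eigenbasis, L multiplies the k-th coefficient by lam k. The operator
   L A^* is the pointwise limit of its truncations to the first n coefficients,
   which are bounded because the k-th one is lam k * <A (phi k), y> and whose
   norms increase with n; hence the norm of L A^* y is lower semicontinuous in y,
   and Baire's theorem, in the form of nested balls, gives boundedness. For g = f - P_n f, only coefficients k >= n of A^* A g contribute
   to |A g|^2 = <A^* A g, g>, and these are the coefficients of L A^* A g divided
   by lam k, whence |A g|^2 <= |lam n|^-1 |L A^*| |A g| |g|. For the
   pseudo-inverse, |L L^dagger| = 1 and f = phi n attains the bound. It maps
   bounded sets to sets bounded in the graph norm, so it is compact. *)

(** * Elementary rules for linear maps *)

Section LinearMap.
Variables (F : pzRingType) (V W : lmodType F) (f : V -> W).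
Hypothesis f_linear : linear f.

Lemma linear_map0 : f 0 = 0.
Proof.
by have := f_linear 1 0 0; rewrite !scale1r add0r -[LHS]addr0 => /addrI.
Qed.

Lemma linear_mapZ a x : f (a *: x) = a *: f x.
Proof. by rewrite -[a *: x]addr0 f_linear linear_map0 addr0. Qed.

Lemma linear_mapB x y : f (x - y) = f x - f y.
Proof. by rewrite addrC -scaleN1r f_linear scaleN1r addrC. Qed.

End LinearMap.

(** * Real and complex scalars treated uniformly: modulus, conjugation, embedding of [R] *)

Section Scalars.
Variables (R : realType) (s : scalar_kind).
Local Notation K := (scalar_field R s).
Local Notation conj := (@conj_scalar R s).
Local Notation rl := (@of_real R s).

(** The modulus as an element of [R]; the library norm of a scalar lies in [K]. *)
Definition rabs (a : K) : R := re_scalar `|a|.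

Lemma conj_scalarD : {morph conj : a b / a + b}.
Proof. by case: s => //= a b; rewrite rmorphD. Qed.

Lemma conj_scalarM : {morph conj : a b / a * b}.
Proof. by case: s => //= a b; rewrite rmorphM. Qed.

Lemma conj_scalarK : involutive conj.
Proof. by case: s => //= a; rewrite conjcK. Qed.

Lemma conj_scalar0 : conj 0 = 0.
Proof. by apply: (addrI (conj 0)); rewrite -conj_scalarD !addr0. Qed.

Lemma conj_scalar_real (x : R) : conj (rl x) = rl x.
Proof. by case: s => //; exact: conjc_real. Qed.

Lemma of_real_additive : {morph rl : x y / x + y}.
Proof. by case: s => //= x y; exact: (rmorphD (real_complex R)). Qed.

Lemma of_realM : {morph rl : x y / x * y}.
Proof. by case: s => //= x y; exact: (rmorphM (real_complex R)). Qed.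

Lemma of_real0 : rl 0 = 0.
Proof. by case: s. Qed.

Lemma of_real1 : rl 1 = 1.
Proof. by case: s. Qed.

Lemma ler_of_real (x y : R) : (rl x <= rl y) = (x <= y).
Proof. by case: s => //; exact: lecR. Qed.

Lemma ltr_of_real (x y : R) : (rl x < rl y) = (x < y).
Proof. by case: s => //; exact: ltcR. Qed.

Lemma of_real_inj : injective rl.
Proof. by move=> x y /eqP; rewrite eq_le !ler_of_real -eq_le => /eqP. Qed.

(** In the complex order, [0 <= a] forces the imaginary part to vanish. This links norms valued in
    [K] with their real versions. *)
Lemma of_real_re (a : K) : 0 <= a -> rl (re_scalar a) = a.
Proof.
by move: a; case: s => //= -[a b]; rewrite lecE /= => /andP[/eqP -> _].
Qed.

Lemma of_real_rabs (a : K) : rl (rabs a) = `|a|.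
Proof. by rewrite of_real_re. Qed.

Lemma rabs_ge0 (a : K) : 0 <= rabs a.
Proof. by rewrite -ler_of_real of_real_rabs of_real0. Qed.

Lemma rabsM (a b : K) : rabs (a * b) = rabs a * rabs b.
Proof. by apply: of_real_inj; rewrite of_realM !of_real_rabs normrM. Qed.

Lemma ler_rabsD (a b : K) : rabs (a + b) <= rabs a + rabs b.
Proof. by rewrite -ler_of_real of_real_additive !of_real_rabs ler_normD. Qed.

Lemma rabs0 : rabs 0 = 0.
Proof. by apply: of_real_inj; rewrite of_real_rabs normr0 of_real0. Qed.

Lemma rabs_eq0 (a : K) : (rabs a == 0) = (a == 0).
Proof.
by rewrite -(inj_eq of_real_inj) of_real_rabs of_real0 normr_eq0.
Qed.

Lemma rabsN (a : K) : rabs (- a) = rabs a.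
Proof. by rewrite /rabs normrN. Qed.

Lemma rabs_real (x : R) : rabs (rl x) = `|x|.
Proof.
apply: of_real_inj; rewrite of_real_rabs.
by case: s => //=; rewrite [LHS]normc_def /= expr0n addr0 sqrtr_sqr.
Qed.

Lemma conj_scalar_mul (a : K) : conj a * a = rl (rabs a ^+ 2).
Proof.
rewrite expr2 of_realM of_real_rabs -expr2; move: a.
case: s => /= a; first by rewrite real_normK ?num_real.
by rewrite sqr_normc mulrC.
Qed.

Lemma rabs_conj (a : K) : rabs (conj a) = rabs a.
Proof.
apply/eqP; rewrite -(eqrXn2 (n := 2)) ?rabs_ge0//; apply/eqP/of_real_inj.
by rewrite -!conj_scalar_mul conj_scalarK mulrC.
Qed.

End Scalars.

(** * Inner product calculus, Pythagoras and Cauchy-Schwarz *)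

Section InnerProduct.
Variables (R : realType) (s : scalar_kind) (H : hilbertType R s).
Local Notation K := (scalar_field R s).
Local Notation conj := (@conj_scalar R s).
Implicit Types (x y z : H) (a : K).

Lemma of_real_rnorm x : of_real s (rnorm x) = `|x|.
Proof. by rewrite of_real_re. Qed.

Lemma rnorm_ge0 x : 0 <= rnorm x.
Proof. by rewrite -(ler_of_real s) of_real_rnorm of_real0. Qed.

Lemma rnormZ a x : rnorm (a *: x) = rabs a * rnorm x.
Proof.
apply: (@of_real_inj _ s); rewrite of_realM of_real_rabs !of_real_rnorm.
by rewrite normrZ.
Qed.

Lemma ler_rnormD x y : rnorm (x + y) <= rnorm x + rnorm y.
Proof. by rewrite -(ler_of_real s) of_real_additive !of_real_rnorm ler_normD. Qed.

Lemma rnorm0 : rnorm (0 : H) = 0.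
Proof. by apply: (@of_real_inj _ s); rewrite of_real_rnorm normr0 of_real0. Qed.

Lemma rnorm_eq0 x : (rnorm x == 0) = (x == 0).
Proof. by rewrite -(inj_eq (@of_real_inj _ s)) of_real_rnorm of_real0 normr_eq0. Qed.

Lemma rnormN x : rnorm (- x) = rnorm x.
Proof. by rewrite /rnorm normrN. Qed.

Lemma rnormB x y : rnorm (x - y) = rnorm (y - x).
Proof. by rewrite -rnormN opprB. Qed.

Lemma innerxx x : inner x x = of_real s (rnorm x ^+ 2).
Proof. by rewrite inner_norm expr2 of_realM of_real_rnorm. Qed.

Lemma innerDr x y z : inner x (y + z) = inner x y + inner x z.
Proof. by rewrite -[y]scale1r inner_linear scale1r mul1r. Qed.

Lemma inner0r x : inner x 0 = 0.
Proof. by apply: (addrI (inner x 0)); rewrite -innerDr !addr0. Qed.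

Lemma innerZr x a y : inner x (a *: y) = a * inner x y.
Proof. by rewrite -[a *: y]addr0 inner_linear inner0r addr0. Qed.

Lemma innerBr x y z : inner x (y - z) = inner x y - inner x z.
Proof. by rewrite innerDr -scaleN1r innerZr mulN1r. Qed.

Lemma innerDl x y z : inner (x + y) z = inner x z + inner y z.
Proof. by rewrite inner_conj innerDr conj_scalarD -!inner_conj. Qed.

Lemma inner0l x : inner 0 x = 0.
Proof. by rewrite inner_conj inner0r conj_scalar0. Qed.

Lemma innerZl a x y : inner (a *: x) y = conj a * inner x y.
Proof. by rewrite inner_conj innerZr conj_scalarM -inner_conj. Qed.

Lemma innerBl x y z : inner (x - y) z = inner x z - inner y z.
Proof.
rewrite innerDl; congr (_ + _); apply/eqP.
by rewrite -addr_eq0 -innerDl addNr inner0l.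
Qed.

Lemma inner_eq0C x y : inner x y = 0 -> inner y x = 0.
Proof. by move=> xy0; rewrite inner_conj xy0 conj_scalar0. Qed.

Lemma rnorm_pythagoras x y :
  inner x y = 0 -> rnorm (x + y) ^+ 2 = rnorm x ^+ 2 + rnorm y ^+ 2.
Proof.
move=> xy0; apply: (@of_real_inj _ s); rewrite of_real_additive -!innerxx.
by rewrite innerDl !innerDr xy0 (inner_eq0C xy0) addr0 add0r.
Qed.

Lemma rnorm_pythagoras_le x y : inner x y = 0 -> rnorm x <= rnorm (x + y).
Proof.
move=> /rnorm_pythagoras xy; rewrite -(@ler_pXn2r _ 2) ?nnegrE ?rnorm_ge0//.
by rewrite xy lerDl sqr_ge0.
Qed.

(** The projection [a *: x] of [y] onto the line of [x] is orthogonal to the remainder, so by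
    Pythagoras it is no longer than [y]. *)
Lemma cauchy_schwarz x y : rabs (inner x y) <= rnorm x * rnorm y.
Proof.
have [->|x0] := eqVneq x 0; first by rewrite inner0l rabs0 rnorm0 mul0r.
have nx0 : rnorm x != 0 by rewrite rnorm_eq0.
have nx : 0 < rnorm x by rewrite lt_neqAle eq_sym nx0 rnorm_ge0.
set a := of_real s (rnorm x ^- 2) * inner x y.
have ax : inner x (y - a *: x) = 0.
  rewrite innerBr innerZr innerxx mulrAC -of_realM mulVf ?expf_neq0//.
  by rewrite of_real1 mul1r subrr.
have /rnorm_pythagoras_le : inner (a *: x) (y - a *: x) = 0.
  by rewrite innerZl ax mulr0.
rewrite addrC subrK rnormZ rabsM rabs_real => axy.
rewrite -(ler_pM2l (x := (rnorm x)^-1)) ?invr_gt0//.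
rewrite [leRHS]mulrA mulVf// mul1r; apply: le_trans axy.
rewrite ger0_norm ?invr_ge0 ?sqr_ge0// le_eqVlt; apply/orP; left.
by apply/eqP; field.
Qed.

End InnerProduct.

(** * Convergence and completeness in terms of the real-valued norm *)

Section Convergence.
Variables (R : realType) (s : scalar_kind) (H : hilbertType R s).
Local Notation K := (scalar_field R s).
Implicit Types (x y z : H) (u : nat -> H).

Lemma of_real_gt0 (e : K) : 0 < e -> exists2 e' : R, 0 < e' & e = of_real s e'.
Proof.
move=> e0; exists (re_scalar e); last by rewrite of_real_re// ltW.
by rewrite -(ltr_of_real s) of_real_re ?of_real0// ltW.
Qed.

Lemma rnorm_cvgP u l : u @ \oo --> l <->
  forall e : R, 0 < e -> exists N, forall n, (N <= n)%N -> rnorm (l - u n) < e.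
Proof.
split=> [/cvgrPdist_lt ul e e0|ul].
  have [|N _ uN] := ul (of_real s e).
    by rewrite -(of_real0 R s) ltr_of_real.
  by exists N => n /uN /=; rewrite -of_real_rnorm ltr_of_real.
apply/cvgrPdist_lt => _ /of_real_gt0[e e0 ->].
have [N uN] := ul e e0; exists N => // n /uN /=.
by rewrite -of_real_rnorm ltr_of_real.
Qed.

Lemma rnorm_cauchy_cvg u :
  (forall e : R, 0 < e ->
     exists N, forall n, (N <= n)%N -> rnorm (u N - u n) < e) ->
  cvgn u.
Proof.
move=> u_cauchy; apply/cauchy_cvgP/cauchy_exP => _ /of_real_gt0[e e0 ->].
have [N uN] := u_cauchy e e0; exists (u N); exists N => // n /uN /=.
by rewrite -ball_normE /= -of_real_rnorm ltr_of_real.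
Qed.

Lemma rnorm_cvg_le u l (B : R) : u @ \oo --> l ->
  (exists N, forall n, (N <= n)%N -> rnorm (u n) <= B) -> rnorm l <= B.
Proof.
move=> /rnorm_cvgP ul [N uB]; apply/ler_addgt0Pr => e /ul[M uM].
rewrite -[l](subrK (u (maxn N M))) (le_trans (ler_rnormD _ _))// addrC.
by rewrite lerD ?uB ?leq_maxl// ltW// uM// leq_maxr.
Qed.

Lemma closure_rnorm (A : set H) x (e : R) : closure A x -> 0 < e ->
  exists2 v, A v & rnorm (x - v) < e.
Proof.
move=> clA e0; have [|v [Av xv]] := clA (ball x (of_real s e)).
  by apply: nbhsx_ballx; rewrite -(of_real0 R s) ltr_of_real.
by exists v => //; move: xv; rewrite -ball_normE /= -of_real_rnorm ltr_of_real.
Qed.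

Lemma inner_cvg_coef u l x (a : K) : u @ \oo --> l ->
  (exists N, forall n, (N <= n)%N -> inner x (u n) = a) -> inner x l = a.
Proof.
move=> /rnorm_cvgP ul [N ua]; apply/eqP; rewrite -subr_eq0 -rabs_eq0.
rewrite eq_le rabs_ge0 andbT; apply/ler_addgt0Pr => e e0; rewrite add0r.
(* Adding 1 keeps the divisor positive when [x = 0]. *)
have x1 : 0 < rnorm x + 1 by rewrite ltr_wpDl// rnorm_ge0.
have [M uM] := ul (e / (rnorm x + 1)) (divr_gt0 e0 x1).
rewrite -(ua (maxn N M)) ?leq_maxl// -innerBr (le_trans (cauchy_schwarz _ _))//.
have /ltW := uM _ (leq_maxr N M); rewrite ler_pdivlMr//; apply: le_trans.
by rewrite mulrC ler_wpM2l ?rnorm_ge0// lerDl.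
Qed.

End Convergence.

(** * Boundedness of lower semicontinuous linear maps, by nested balls *)

Section NestedBalls.
Variables (R : realType) (s : scalar_kind) (V W : hilbertType R s).
Variable T : V -> W.
Hypothesis T_linear : linear T.
Hypothesis T_lsc : forall (c : R) x, c < rnorm (T x) ->
  exists2 r : R, 0 < r & forall y, rnorm (y - x) < r -> c < rnorm (T y).

Let TZ := linear_mapZ T_linear.

Hypothesis T_unbounded : forall M : R, exists x, M * rnorm x < rnorm (T x).

(** A vector on which [T] stretches by more than [c / r] is rescaled to length [r]; moving from [x]
    along it, forwards or backwards, reaches a large value. *)
Let T_large (x : V) (r c : R) : 0 < r ->
  exists2 y, rnorm (y - x) <= r & c < rnorm (T y).
Proof.
move=> r0; wlog c0 : c / 0 <= c.
  move=> hyp; have [//|y xy cy] := hyp `|c|; exists y => //.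
  exact: le_lt_trans (ler_norm _) cy.
have [z z_large] := T_unbounded (c / r).
have z0 : 0 < rnorm z.
  rewrite lt_neqAle rnorm_ge0 eq_sym rnorm_eq0 andbT.
  apply/eqP => z0; move: z_large; rewrite z0 rnorm0 mulr0.
  by rewrite (linear_map0 T_linear) rnorm0 ltxx.
pose t := of_real s (r / rnorm z).
have tr : rnorm (t *: z) = r.
  rewrite rnormZ rabs_real ger0_norm ?divr_ge0 ?rnorm_ge0 ?ltW//.
  by rewrite divfK// gt_eqF.
have tc : c < rnorm (T (t *: z)).
  rewrite TZ rnormZ rabs_real ger0_norm ?divr_ge0 ?rnorm_ge0 ?ltW//.
  move: z_large; rewrite mulrAC ltr_pdivrMr// => z_large.
  by rewrite mulrAC ltr_pdivlMr// [r * _]mulrC.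
(* [T (x + t *: z)] and [T (x - t *: z)] cannot both be small, as they differ
   by [2 *: T (t *: z)]. *)
have [cp|cp] := ltP c (rnorm (T (x + t *: z))).
  by exists (x + t *: z) => //; rewrite addrC addKr tr.
exists (x - t *: z); first by rewrite addrC addKr rnormN tr.
rewrite ltNge; apply/negP => cm; move: tc; apply/negP; rewrite -leNgt.
have -> : T (t *: z) = (2^-1 : scalar_field R s) *: (T (x + t *: z) - T (x - t *: z)).
  rewrite -(linear_mapB T_linear) opprB addrC addrA subrK -mulr2n.
  by rewrite -(scaler_nat _ (t *: z)) (TZ _ (t *: z)) scalerA mulVf ?scale1r// pnatr_eq0.
have -> : (2^-1 : scalar_field R s) = of_real s 2^-1.
  apply: (mulfI (x := 2)); rewrite ?pnatr_eq0// divff ?pnatr_eq0//.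
  rewrite mulr_natl mulr2n -of_real_additive (_ : 2^-1 + 2^-1 = 1) ?of_real1//.
  by lra.
rewrite rnormZ rabs_real ger0_norm ?invr_ge0 ?ler0n// ler_pdivrMl//.
by rewrite (le_trans (ler_rnormD _ _))// rnormN mulr_natl mulr2n lerD.
Qed.

(** Pairs are closed balls, centre and radius; the third clause says that the ball [q] lies inside
    [p]. Positivity of the radius is a premise inside the subset type, so that [step] is total and
    can be iterated. *)
Let step (n : nat) (p : V * R) : { q : V * R | 0 < p.2 ->
  [/\ 0 < q.2, q.2 <= p.2 / 2, rnorm (q.1 - p.1) <= p.2 - q.2 &
      forall y, rnorm (y - q.1) <= q.2 -> n%:R < rnorm (T y)] }.
Proof.
apply: cid; have [p0|p0] := ltP 0 p.2; last by exists p; rewrite ltNge p0.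
have [y yp yn] := T_large p.1 n%:R (divr_gt0 p0 (ltr0n _ 2)).
have [r r0 ry] := T_lsc yn.
(* Since [y] is within [p.2 / 2] of the old centre, a radius of at most [p.2 / 2] stays inside [p];
   [r / 2] puts the closed ball inside the open ball given by semicontinuity. *)
exists (y, Num.min (p.2 / 2) (r / 2)) => _ /=; split.
- by rewrite lt_min !divr_gt0.
- by rewrite ge_min lexx.
- have : Num.min (p.2 / 2) (r / 2) <= p.2 / 2 by rewrite ge_min lexx.
  by move: yp; lra.
- move=> z /le_lt_trans zy; apply: ry; apply: zy.
  by rewrite gt_min; apply/orP; right; lra.
Qed.

(** The radii at least halve, so the centres converge to a point [l] of all the balls, and the norm
    of [T l] would exceed every natural number. *)
Lemma nested_balls_false : False.
Proof.
pose q := fix q n : V * R := if n is m.+1 then sval (step m (q m)) else (0, 1).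
have q0 n : 0 < (q n).2.
  by elim: n => //= n IH; have [] := svalP (step n (q n)) IH.
have qS n := svalP (step n (q n)) (q0 n).
have q_small n : (q n).2 <= 2^-1 ^+ n.
  elim: n => [|n IH]; first by rewrite expr0.
  have [_ /le_trans + _ _] := qS n; apply.
  by rewrite exprSr ler_pM2r.
(* The bound is a difference of radii so that the induction telescopes. *)
have q_near m n : rnorm ((q (n + m)%N).1 - (q n).1) <= (q n).2 - (q (n + m)%N).2.
  elim: m => [|m IH]; first by rewrite addn0 !subrr rnorm0.
  rewrite addnS; have [_ _ + _] := qS (n + m)%N => qm.
  rewrite -(subrK (q (n + m)%N).1 (q (n + m).+1).1) -addrA.
  by rewrite (le_trans (ler_rnormD _ _))// (le_trans (lerD qm IH))//; lra.
have q_near' m n : (n <= m)%N -> rnorm ((q m).1 - (q n).1) <= (q n).2.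
  move=> /subnKC <-; rewrite (le_trans (q_near _ _))//.
  by rewrite gerDl oppr_le0 ltW.
have /cvg_ex[/= l ql] : cvgn (fun n => (q n).1).
  apply: rnorm_cauchy_cvg => e e0.
  have [N Ne] : exists N, 2^-1 ^+ N < e.
    have : (fun n => 2^-1 ^+ n : R) @ \oo --> (0 : R).
      by apply: cvg_expr; rewrite ger0_norm ?invr_ge0// invf_lt1// ltr1n.
    move=> /cvgrPdist_lt/(_ e e0)[N _ /(_ N (leqnn N))] /=.
    by rewrite sub0r normrN ger0_norm ?exprn_ge0 ?invr_ge0//; exists N.
  exists N => n Nn; rewrite rnormB (le_lt_trans (q_near' _ _ Nn))//.
  exact: le_lt_trans (q_small N) Ne.
have ln n : rnorm (l - (q n).1) <= (q n).2.
  apply: (@rnorm_cvg_le _ _ _ (fun m => (q m).1 - (q n).1)).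
    by apply: cvgB => //; exact: cvg_cst.
  by exists n => m; exact: q_near'.
have := archi_boundP (rnorm_ge0 (T l)); set n := Num.bound _ => nT.
(* The ball on which [T] exceeds [n] is [q n.+1], hence the shift. *)
by have [_ _ _ /(_ l (ln n.+1)) /lt_trans/(_ nT)] := qS n; rewrite ltxx.
Qed.

End NestedBalls.

Lemma lsc_linear_bounded (R : realType) (s : scalar_kind)
    (V W : hilbertType R s) (T : V -> W) :
  linear T ->
  (forall (c : R) x, c < rnorm (T x) ->
     exists2 r : R, 0 < r & forall y, rnorm (y - x) < r -> c < rnorm (T y)) ->
  exists M : R, forall x, rnorm (T x) <= M * rnorm x.
Proof.
move=> T_linear T_lsc; apply: contrapT => T_unbounded.
apply: (nested_balls_false T_linear T_lsc) => M; apply: contrapT => M_bound.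
apply: T_unbounded; exists M => x; rewrite leNgt; apply/negP => Mx.
by apply: M_bound; exists x.
Qed.

(** * Finite combinations and Fourier sums of an orthonormal sequence *)

Section Orthonormal.
Variables (R : realType) (s : scalar_kind) (H : hilbertType R s).
Local Notation K := (scalar_field R s).
Variable phi : nat -> H.
Hypothesis phi_orthonormal : orthonormal_seq phi.
Implicit Types (x y z : H) (c : nat -> K) (m : nat -> R).

(** The coefficients are arbitrary, so that Fourier sums, diagonal operators and Riesz
    representatives share one theory; [comb c n] uses the indices below [n]. *)
Definition comb c : nat -> H := series (fun k => c k *: phi k).

Definition fourier x : nat -> H := comb (fun k => inner (phi k) x).

Lemma combS c n : comb c n.+1 = comb c n + c n *: phi n.
Proof. by rewrite /comb !seriesEnat /= big_nat_recr. Qed.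

Lemma comb0 c : comb c 0 = 0.
Proof. by rewrite /comb seriesEnat /= big_geq. Qed.

Lemma eq_comb c c' n : (forall k, (k < n)%N -> c k = c' k) -> comb c n = comb c' n.
Proof.
move=> cc'; rewrite /comb !seriesEnat /=.
by apply: eq_big_nat => k /andP[_ /cc' ->].
Qed.

Lemma comb_eq0 n : comb (fun=> 0) n = 0.
Proof. by rewrite /comb seriesEnat /= big1// => k _; rewrite scale0r. Qed.

Lemma rnorm_phi k : rnorm (phi k) = 1.
Proof.
apply/eqP; rewrite -(eqrXn2 (n := 2)) ?rnorm_ge0//; apply/eqP.
apply: (@of_real_inj _ s); rewrite -innerxx phi_orthonormal eqxx.
by rewrite expr1n of_real1.
Qed.

Lemma inner_phi_comb j c n : inner (phi j) (comb c n) = if (j < n)%N then c j else 0.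
Proof.
elim: n => [|n IH]; first by rewrite comb0 inner0r.
rewrite combS innerDr IH innerZr phi_orthonormal ltnS [in RHS]leq_eqVlt.
have [->|_] := eqVneq j n; first by rewrite ltnn mulr1 add0r.
by rewrite mulr0 addr0.
Qed.

Lemma inner_comb_eq0 c n z :
  (forall k, (k < n)%N -> inner (phi k) z = 0) -> inner (comb c n) z = 0.
Proof.
elim: n => [|n IH] z0; first by rewrite comb0 inner0l.
by rewrite combS innerDl innerZl z0// mulr0 addr0 IH// => k /ltnW /z0.
Qed.

Lemma rnorm_comb c n : rnorm (comb c n) ^+ 2 = \sum_(0 <= k < n) rabs (c k) ^+ 2.
Proof.
elim: n => [|n IH]; first by rewrite comb0 rnorm0 expr0n big_geq.
rewrite combS rnorm_pythagoras ?IH.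
  by rewrite big_nat_recr//= rnormZ rnorm_phi mulr1.
apply: inner_eq0C; rewrite innerZl inner_phi_comb ltnn.
by rewrite mulr0.
Qed.

Lemma rnorm_comb_bound c c' (C : R) n : 0 <= C ->
  (forall k, rabs (c k) <= C * rabs (c' k)) ->
  rnorm (comb c n) <= C * rnorm (comb c' n).
Proof.
move=> C0 cc'; rewrite -(@ler_pXn2r _ 2) ?nnegrE ?mulr_ge0 ?rnorm_ge0//.
rewrite exprMn !rnorm_comb mulr_sumr; apply: ler_sum => k _.
by rewrite -exprMn ler_pXn2r ?nnegrE ?mulr_ge0 ?rabs_ge0.
Qed.

Lemma rnorm_comb_sub c i n : (i <= n)%N ->
  rnorm (comb c i - comb c n) ^+ 2 = rnorm (comb c n) ^+ 2 - rnorm (comb c i) ^+ 2.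
Proof.
move=> le_in.
have /rnorm_pythagoras : inner (comb c i) (comb c n - comb c i) = 0.
  apply: inner_comb_eq0 => k ki.
  by rewrite innerBr !inner_phi_comb ki (leq_trans ki le_in) subrr.
by rewrite addrC subrK rnormB => ->; rewrite addrAC subrr add0r.
Qed.

(** The squared norms of the partial sums increase and are bounded, hence converge; by
    [rnorm_comb_sub] their increments are squared distances, so the partial sums are Cauchy. *)
Lemma riesz_fischer c (B : R) : (forall n, rnorm (comb c n) <= B) -> cvgn (comb c).
Proof.
move=> cB; pose a n := rnorm (comb c n) ^+ 2.
have a_cvg : cvgn a.
  apply: nondecreasing_is_cvgn.
    move=> i j ij; rewrite /a -subr_ge0 -rnorm_comb_sub//.
    exact: sqr_ge0.
  exists (B ^+ 2) => _ [n _ <-]; rewrite /a ler_pXn2r ?nnegrE ?rnorm_ge0//.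
  exact: le_trans (rnorm_ge0 _) (cB n).
have a_sup n : a n <= limn a.
  apply: nondecreasing_cvgn_le => // i j ij.
  by rewrite /a -subr_ge0 -rnorm_comb_sub// sqr_ge0.
apply: rnorm_cauchy_cvg => e e0.
move/cvgrPdist_lt: a_cvg => /(_ _ (exprn_gt0 2 e0))[N _ aN].
exists N => n Nn; rewrite -(@ltr_pXn2r _ 2) ?nnegrE ?rnorm_ge0 ?ltW//.
rewrite rnorm_comb_sub// -!/(a _).
have := aN N (leqnn N) => /=; rewrite ger0_norm ?subr_ge0//.
by have := a_sup n; lra.
Qed.

Lemma inner_phi_lim k c : cvgn (comb c) -> inner (phi k) (limn (comb c)) = c k.
Proof.
move=> c_cvg; apply: (inner_cvg_coef c_cvg); exists k.+1 => n kn.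
by rewrite inner_phi_comb kn.
Qed.

Lemma inner_phi_fourier k n x :
  inner (phi k) (x - fourier x n) = if (k < n)%N then 0 else inner (phi k) x.
Proof. by rewrite innerBr inner_phi_comb; case: ifP; rewrite ?subrr ?subr0. Qed.

Lemma inner_comb_residual c n x : inner (comb c n) (x - fourier x n) = 0.
Proof. by apply: inner_comb_eq0 => k kn; rewrite inner_phi_fourier kn. Qed.

Lemma bessel x n : rnorm (fourier x n) <= rnorm x.
Proof.
rewrite -[x in leRHS](subrK (fourier x n)) addrC.
exact/rnorm_pythagoras_le/inner_comb_residual.
Qed.

Lemma rnorm_residual x n : rnorm (x - fourier x n) <= rnorm x.
Proof.
rewrite -[x in leRHS](subrK (fourier x n)).
exact/rnorm_pythagoras_le/inner_eq0C/inner_comb_residual.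
Qed.

Lemma fourierD x y n : fourier (x + y) n = fourier x n + fourier y n.
Proof.
elim: n => [|n IH]; rewrite /fourier ?comb0 ?addr0// !combS -!/(fourier _ _).
by rewrite IH innerDr scalerDl addrACA.
Qed.

Lemma fourierZ a x n : fourier (a *: x) n = a *: fourier x n.
Proof.
elim: n => [|n IH]; rewrite /fourier ?comb0 ?scaler0// !combS -!/(fourier _ _).
by rewrite IH innerZr scalerDr scalerA.
Qed.

Lemma fourier_phi k n : (k < n)%N -> fourier (phi k) n = phi k.
Proof.
elim: n => // n IH; rewrite ltnS leq_eqVlt => /predU1P[->|kn].
  rewrite /fourier combS phi_orthonormal eqxx scale1r.
  rewrite (@eq_comb _ (fun=> 0)) => [|i i_n].
    by rewrite comb_eq0 add0r.
  by rewrite phi_orthonormal (ltn_eqF i_n).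
by rewrite /fourier combS -/(fourier _ _) IH// phi_orthonormal gtn_eqF// scale0r addr0.
Qed.

Lemma fourier_sum (I : Type) (r : seq I) (a : I -> K) (v : I -> H) n :
  fourier (\sum_(i <- r) a i *: v i) n = \sum_(i <- r) a i *: fourier (v i) n.
Proof.
elim: r => [|i r IH]; last by rewrite !big_cons fourierD fourierZ IH.
by rewrite !big_nil -[0 : H](scale0r 0) fourierZ !scale0r.
Qed.

Lemma comb_in_span c n : lin_span [set phi k | k in [set k | (k < n)%N]] (comb c n).
Proof.
exists n, (fun i => phi i), (fun i => c i); split; first by move=> i; exists i => //=.
by rewrite /comb seriesEnat /= big_mkord.
Qed.

Lemma fourier_span n x :
  lin_span [set phi k | k in [set k | (k < n)%N]] x -> fourier x n = x.
Proof.
move=> [d [v [a [v_phi ->]]]]; rewrite fourier_sum; apply: eq_bigr => i _.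
by have [k kn <-] := v_phi i; rewrite fourier_phi.
Qed.

(** The Fourier sum lies in the span and its residual is orthogonal to it. Any other candidate [p]
    equals its own Fourier sum, and orthogonality of [x - p] to each [phi k] gives it the
    coefficients of [x]. *)
Lemma orth_proj_span n x :
  orth_proj (lin_span [set phi k | k in [set k | (k < n)%N]]) x = fourier x n.
Proof.
set S := lin_span _; apply: xget_unique => [|p [Sp x_p]].
  split=> [|v /fourier_span <-]; first exact: comb_in_span.
  exact: inner_comb_residual.
rewrite -(fourier_span Sp); apply: eq_comb => k kn.
apply/eqP; rewrite -subr_eq0 -opprB oppr_eq0 -innerBr x_p//.
exists 1%N, (fun=> phi k), (fun=> 1); split; first by move=> _; exists k.
by rewrite big_ord1 scale1r.
Qed.

End Orthonormal.

(** * Fourier expansion in an orthonormal basis *)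

Section Basis.
Variables (R : realType) (s : scalar_kind) (H : hilbertType R s).
Local Notation K := (scalar_field R s).
Local Notation conj := (@conj_scalar R s).
Local Notation rl := (@of_real R s).
Variable phi : nat -> H.
Hypothesis phi_basis : orthonormal_basis phi.
Implicit Types (x y z : H) (c : nat -> K) (m : nat -> R).

Let phi_orthonormal : orthonormal_seq phi := proj1 phi_basis.

(** Long Fourier sums fix a finite combination [v] close to [x], so the residual of [x] is that of
    [x - v], which is no longer than [x - v]. *)
Lemma fourier_cvg x : fourier phi x @ \oo --> x.
Proof.
apply/rnorm_cvgP => e e0.
have x_cl : closure (lin_span (range phi)) x by rewrite (proj2 phi_basis).
have [v [d [w [a [w_phi v_sum]]]] xv] := closure_rnorm x_cl e0.
have /choice[k wk] i : exists k, w i = phi k.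
  by have [k _ <-] := w_phi i; exists k.
exists (\max_i k i).+1 => n kn.
have v_fix : fourier phi v n = v.
  apply: fourier_span => //; exists d, w, a; split=> // i.
  rewrite wk; exists (k i) => //=; apply: leq_trans kn.
  by rewrite ltnS leq_bigmax.
have -> : x - fourier phi x n = (x - v) - fourier phi (x - v) n.
  rewrite fourierD -[- v]scaleN1r fourierZ v_fix scaleN1r opprD opprK.
  by rewrite addrACA addNr addr0.
exact: le_lt_trans (rnorm_residual phi_orthonormal _ _) xv.
Qed.

Lemma rnorm_le_fourier x (B : R) : (forall n, rnorm (fourier phi x n) <= B) ->
  rnorm x <= B.
Proof. by move=> xB; apply: (rnorm_cvg_le (@fourier_cvg x)); exists 0%N. Qed.

Lemma fourier_ext x y : (forall k, inner (phi k) x = inner (phi k) y) -> x = y.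
Proof.
move=> xy; apply/eqP; rewrite -subr_eq0 -rnorm_eq0 eq_le rnorm_ge0 andbT.
apply: rnorm_le_fourier => n; rewrite /fourier (@eq_comb _ _ _ _ _ (fun=> 0)).
  by rewrite comb_eq0 rnorm0.
by move=> k _; rewrite innerBr xy subrr.
Qed.

(** By linearity [f] vanishes on Fourier sums, and boundedness carries this to the limit. Identities
    between bounded functionals thus need checking only on the basis. *)
Lemma functional_eq0 (f : H -> K) (C : R) :
  (forall a x y, f (a *: x + y) = a * f x + f y) ->
  (forall x, rabs (f x) <= C * rnorm x) ->
  (forall k, f (phi k) = 0) -> forall x, f x = 0.
Proof.
move=> f_lin f_bnd f_phi x.
have f0 : f 0 = 0.
  apply/eqP; rewrite -rabs_eq0 eq_le rabs_ge0 andbT.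
  by rewrite (le_trans (f_bnd 0))// rnorm0 mulr0.
have fF n : f (fourier phi x n) = 0.
  elim: n => [|n IH]; first by rewrite /fourier comb0.
  by rewrite /fourier combS addrC f_lin f_phi mulr0 add0r.
apply/eqP; rewrite -rabs_eq0 eq_le rabs_ge0 andbT.
apply/ler_addgt0Pr => e e0; rewrite add0r.
have C1 : 0 < `|C| + 1 by rewrite ltr_wpDl.
have /rnorm_cvgP/(_ _ (divr_gt0 e0 C1))[n /(_ n (leqnn n))] := @fourier_cvg x.
move=> /ltW; rewrite ler_pdivlMr//; apply: le_trans.
have -> : f x = f (x - fourier phi x n).
  have := f_lin 1 (x - fourier phi x n) (fourier phi x n).
  by rewrite scale1r subrK mul1r fF addr0.
rewrite (le_trans (f_bnd _))// mulrC ler_wpM2l ?rnorm_ge0//.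
by rewrite (le_trans (ler_norm _))// lerDl.
Qed.

(** The diagonal operator with real symbol [m], meaningful for bounded [m]. The pseudo-inverse, its
    composite with [L], and the inverse of [L] cut off below an index all take this form. *)
Definition diag m x : H := limn (comb phi (fun k => rl (m k) * inner (phi k) x)).

(** * Diagonal operators with bounded symbol *)

Section Bounded.
Variables (m : nat -> R) (C : R).
Hypothesis m_bound : forall k, `|m k| <= C.

Let C_ge0 : 0 <= C.
Proof. exact: le_trans (normr_ge0 _) (m_bound 0%N). Qed.

Lemma rnorm_diag_partial x n :
  rnorm (comb phi (fun k => rl (m k) * inner (phi k) x) n) <= C * rnorm x.
Proof.
apply: (@le_trans _ _ (C * rnorm (fourier phi x n))).
  apply: rnorm_comb_bound => // k.
  by rewrite rabsM rabs_real ler_wpM2r ?rabs_ge0.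
by rewrite ler_wpM2l// bessel.
Qed.

Lemma diag_cvg x : cvgn (comb phi (fun k => rl (m k) * inner (phi k) x)).
Proof. exact: riesz_fischer (rnorm_diag_partial x). Qed.

Lemma inner_phi_diag k x : inner (phi k) (diag m x) = rl (m k) * inner (phi k) x.
Proof. by rewrite inner_phi_lim//; exact: diag_cvg. Qed.

Lemma diag_linear : linear (diag m).
Proof.
move=> a x y; apply: fourier_ext => k.
by rewrite innerDr innerZr !inner_phi_diag innerDr innerZr mulrDr mulrCA.
Qed.

Lemma rnorm_diag x : rnorm (diag m x) <= C * rnorm x.
Proof.
apply: (rnorm_cvg_le (@diag_cvg x)); exists 0%N => n _.
exact: rnorm_diag_partial.
Qed.

Lemma diag_bounded : bounded_operator (diag m).
Proof. by split; [exact: diag_linear | exists C => x; exact: rnorm_diag]. Qed.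

(** The difference of the two sides is a bounded functional of [y]; it vanishes on the basis because
    the symbol is real. *)
Lemma diag_symmetric x y : inner (diag m x) y = inner x (diag m y).
Proof.
apply/eqP; rewrite -subr_eq0; apply/eqP; move: y.
apply: (@functional_eq0 _ (C * rnorm x + C * rnorm x)) => [a y z|y|k].
- rewrite diag_linear !innerDr !innerZr.
  by rewrite mulrBr opprD addrACA.
- rewrite (le_trans (ler_rabsD _ _))// rabsN mulrDl lerD//.
    by rewrite (le_trans (cauchy_schwarz _ _))// ler_wpM2r ?rnorm_ge0// rnorm_diag.
  rewrite (le_trans (cauchy_schwarz _ _))// mulrAC mulrC ler_wpM2r ?rnorm_ge0//.
  exact: rnorm_diag.
- have -> : diag m (phi k) = rl (m k) *: phi k.
    apply: fourier_ext => j; rewrite inner_phi_diag innerZr phi_orthonormal.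
    by have [->|] := eqVneq j k; rewrite ?mulr0.
  rewrite innerZr inner_conj inner_phi_diag conj_scalarM conj_scalar_real.
  by rewrite -inner_conj subrr.
Qed.

End Bounded.

(** * Existence and linearity of the adjoint of a bounded operator *)

Section Riesz.
Variables (H' : hilbertType R s) (A : H -> H').
Hypothesis A_bounded : bounded_operator A.

Lemma bounded_operator_nonneg :
  exists2 M : R, 0 <= M & forall x, rnorm (A x) <= M * rnorm x.
Proof.
have [_ [M AM]] := A_bounded; exists `|M| => // x.
by rewrite (le_trans (AM x))// ler_wpM2r ?rnorm_ge0// ler_norm.
Qed.

(** The representative is built from its coefficients [c k], conjugated because [z] stands in the
    conjugate-linear slot. Its partial sums are bounded by [M * rnorm y], so they converge. *)
Lemma riesz_adjoint (y : H') : exists z, forall x, inner y (A x) = inner z x.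
Proof.
have [A_lin _] := A_bounded; have [M M0 AM] := bounded_operator_nonneg.
pose c k := conj (inner y (A (phi k))).
have A0 := linear_map0 A_lin.
(* The functional returns the squared norm of each partial sum; Cauchy-Schwarz and one cancelled
   factor then give the bound. *)
have y_comb n : inner y (A (comb phi c n)) = rl (rnorm (comb phi c n) ^+ 2).
  elim: n => [|n IH]; first by rewrite comb0 A0 inner0r rnorm0 expr0n of_real0.
  rewrite !rnorm_comb// big_nat_recr//= -(rnorm_comb phi_orthonormal) of_real_additive -IH.
  rewrite combS addrC A_lin innerDr innerZr addrC; congr (_ + _).
  by rewrite rabs_conj -conj_scalar_mul.
have c_cvg : cvgn (comb phi c).
  apply: (riesz_fischer phi_orthonormal (B := M * rnorm y)) => n.
  have [->|nz] := eqVneq (rnorm (comb phi c n)) 0.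
    by rewrite mulr_ge0 ?rnorm_ge0.
  rewrite -(ler_pM2r (x := rnorm (comb phi c n))); last first.
    by rewrite lt_neqAle eq_sym nz rnorm_ge0.
  have := cauchy_schwarz y (A (comb phi c n)).
  rewrite y_comb rabs_real ger0_norm ?sqr_ge0// expr2 => /le_trans; apply.
  by rewrite -mulrA [leRHS]mulrCA ler_wpM2l ?rnorm_ge0.
exists (limn (comb phi c)) => x; apply/eqP; rewrite -subr_eq0; apply/eqP; move: x.
apply: (@functional_eq0 _ (rnorm y * M + rnorm (limn (comb phi c)))) => [a x z|x|k].
- by rewrite A_lin !innerDr !innerZr mulrBr opprD addrACA.
- rewrite (le_trans (ler_rabsD _ _))// rabsN mulrDl lerD ?cauchy_schwarz//.
  by rewrite (le_trans (cauchy_schwarz _ _))// -mulrA ler_wpM2l ?rnorm_ge0.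
- by rewrite [inner (limn _) _]inner_conj inner_phi_lim// conj_scalarK subrr.
Qed.

Lemma inner_adjoint (y : H') x : inner (adjoint setT A y) x = inner y (A x).
Proof.
have [z yz] := riesz_adjoint y.
have /(_ x Logic.I) -> // : forall x, setT x ->
    inner y (A x) = inner (adjoint setT A y) x.
exact: (xgetI (P := [set z | forall x, setT x -> inner y (A x) = inner z x]) 0
  (fun x _ => yz x)).
Qed.

Lemma adjoint_linear : linear (adjoint setT A).
Proof.
move=> a y z; apply: fourier_ext => k.
rewrite innerDr innerZr 3!(inner_conj _ (phi k)) !inner_adjoint.
by rewrite innerDl innerZl conj_scalarD conj_scalarM conj_scalarK.
Qed.

End Riesz.

End Basis.

(** * The extended-real operator norm of a bounded operator *)

Section OperatorNorm.
Variables (R : realType) (s : scalar_kind) (H H' : hilbertType R s).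
Variable T : H -> H'.

Lemma opnorm_ge x : rnorm x <= 1 -> ((rnorm (T x))%:E <= opnorm T)%E.
Proof. by move=> x1; apply: ereal_sup_ubound; exists x. Qed.

Lemma opnorm_le (B : R) : (forall x, rnorm x <= 1 -> rnorm (T x) <= B) ->
  (opnorm T <= B%:E)%E.
Proof. by move=> TB; apply: ge_ereal_sup => _ [x x1 <-]; rewrite lee_fin TB. Qed.

(** Replaces the extended-real norm by a real constant; normalising a nonzero [x] to length 1 shows
    that this constant bounds [T] everywhere. *)
Lemma opnorm_bounded : bounded_operator T ->
  exists M : R, [/\ 0 <= M, opnorm T = M%:E & forall x, rnorm (T x) <= M * rnorm x].
Proof.
move=> T_bounded; have [T_lin _] := T_bounded.
have [C C0 TC] := bounded_operator_nonneg T_bounded.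
have T_le : (opnorm T <= C%:E)%E.
  by apply: opnorm_le => x x1; rewrite (le_trans (TC x))// ler_piMr.
have T_ge : (0 <= opnorm T)%E.
  apply: le_trans (opnorm_ge (x := 0) _); last by rewrite rnorm0.
  by rewrite lee_fin rnorm_ge0.
have T_fin : (fine (opnorm T))%:E = opnorm T.
  by apply/fineK/fin_numPlt; rewrite (lt_le_trans _ T_ge)//= (le_lt_trans T_le)// ltry.
exists (fine (opnorm T)); split=> [|//|x]; first by rewrite -lee_fin T_fin.
have [->|x0] := eqVneq x 0.
  by rewrite (le_trans (TC 0))// rnorm0 !mulr0.
have nx : 0 < rnorm x by rewrite lt_neqAle eq_sym rnorm_eq0 x0 rnorm_ge0.
have n0 : 0 <= (rnorm x)^-1 by rewrite invr_ge0 ltW.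
pose a := of_real s (rnorm x)^-1.
have := @opnorm_ge (a *: x).
rewrite (linear_mapZ T_lin) !rnormZ !rabs_real (ger0_norm n0) mulVf ?gt_eqF// => /(_ (lexx _)).
by rewrite -T_fin lee_fin ler_pdivrMl// mulrC.
Qed.

End OperatorNorm.

(** * The self-adjoint operator in its eigenbasis *)

Section SelfAdjoint.
Variables (R : realType) (s : scalar_kind) (H : hilbertType R s).
Local Notation K := (scalar_field R s).
Local Notation conj := (@conj_scalar R s).
Local Notation rl := (@of_real R s).
Variables (D : set H) (L : H -> H) (phi : nat -> H) (lam : nat -> R).
Hypothesis L_self_adjoint : self_adjoint D L.
Hypothesis phi_basis : orthonormal_basis phi.
Hypothesis phi_eigen : forall k, D (phi k) /\ L (phi k) = rl (lam k) *: phi k.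

Lemma self_adjoint_symmetric x y : D x -> D y -> inner x (L y) = inner (L x) y.
Proof.
have [_ _ DE LE] := L_self_adjoint; move=> Dx Dy.
have : adjoint_dom D L x by rewrite DE.
rewrite -[L x]LE// => -[z xz].
exact: (xgetI (P := [set z | forall u, D u -> inner x (L u) = inner z u]) 0 xz).
Qed.

(** Symmetry moves [L] onto [phi k], and the real eigenvalue leaves the first slot unchanged. *)
Lemma inner_phi_eigen k x : D x -> inner (phi k) (L x) = rl (lam k) * inner (phi k) x.
Proof.
move=> Dx; have [Dk Lk] := phi_eigen k.
by rewrite self_adjoint_symmetric// Lk innerZl conj_scalar_real.
Qed.

(** * Boundedness of [L \o adjoint setT A] and the truncation estimate *)

Section SmoothingOperator.
Variables (H' : hilbertType R s) (A : H -> H').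
Hypothesis A_bounded : bounded_operator A.
Hypothesis A_range : range (adjoint setT A) `<=` D.

Let T : H' -> H := L \o adjoint setT A.

Let A_dom y : D (adjoint setT A y).
Proof. by apply: A_range; exists y. Qed.

Let T_linear : linear T.
Proof.
move=> a y z; rewrite /T /= (adjoint_linear phi_basis A_bounded).
by have [_ [_ L_lin] _ _] := L_self_adjoint; have [_ ->] := L_lin a _ _ (A_dom y) (A_dom z).
Qed.

Lemma inner_phi_adjoint k y :
  inner (phi k) (T y) = rl (lam k) * inner (A (phi k)) y.
Proof.
rewrite inner_phi_eigen//; congr (_ * _).
by rewrite inner_conj (inner_adjoint phi_basis A_bounded) -inner_conj.
Qed.

(** The constant may grow with [n]: semicontinuity only asks for each truncation to be
    continuous. *)
Let T_fourier n : exists2 C : R, 0 <= C &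
  forall y, rnorm (fourier phi (T y) n) <= C * rnorm y.
Proof.
elim: n => [|n [C C0 TC]].
  by exists 0 => // y; rewrite /fourier comb0 rnorm0 mul0r.
exists (C + `|lam n| * rnorm (A (phi n))).
  by rewrite addr_ge0// mulr_ge0// rnorm_ge0.
move=> y; rewrite /fourier combS (le_trans (ler_rnormD _ _))// mulrDl lerD//; first exact: TC.
rewrite inner_phi_adjoint rnormZ rabsM rabs_real (rnorm_phi (proj1 phi_basis)).
by rewrite mulr1 -mulrA ler_wpM2l// cauchy_schwarz.
Qed.

Lemma adjoint_smoothing_bounded : bounded_operator T.
Proof.
split; first exact: T_linear.
apply: lsc_linear_bounded T_linear _ => c x cx.
have [n cn] : exists n, c < rnorm (fourier phi (T x) n).
  apply: contrapT => c_all; move: cx; apply/negP; rewrite -leNgt.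
  apply: (rnorm_le_fourier phi_basis) => n; rewrite leNgt.
  by apply/negP => cn; apply: c_all; exists n.
have [C C0 TC] := T_fourier n.
have C1 : 0 < C + 1 by rewrite ltr_wpDl.
(* Within this radius the truncation changes by less than its excess over [c]; by Bessel, [T y] is
   at least as long as its truncation. *)
exists ((rnorm (fourier phi (T x) n) - c) / (C + 1)).
  by rewrite divr_gt0// subr_gt0.
move=> y; rewrite ltr_pdivlMr// => yx.
apply: lt_le_trans (bessel (proj1 phi_basis) (T y) n).
have -> : T y = T x - T (x - y).
  by rewrite (linear_mapB T_linear) subKr.
have : rnorm (fourier phi (T x) n) <=
    rnorm (fourier phi (T x - T (x - y)) n) + rnorm (fourier phi (T (x - y)) n).
  by apply: le_trans (ler_rnormD _ _); rewrite -fourierD subrK.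
have := TC (x - y); rewrite rnormB.
have : C * rnorm (y - x) <= rnorm (y - x) * (C + 1).
  by rewrite mulrC ler_wpM2l ?rnorm_ge0// lerDl.
by lra.
Qed.

Hypothesis lam_ordered : forall i j, (i <= j)%N -> `|lam i| <= `|lam j|.

(* With [g := f - fourier phi f n], [|A g|^2 = <A* A g, g>], and since the
   coefficients of [g] vanish below [n], [A* A g] may be replaced by
   [diag m (L A* A g)] where [m k = (lam k)^-1] for [n <= k]. *)
Lemma truncation_le (M : R) n f :
  (forall y, rnorm (T y) <= M * rnorm y) -> 0 <= M -> lam n != 0 ->
  rnorm (A f - A (fourier phi f n)) <= `|lam n|^-1 * M * rnorm f.
Proof.
move=> TM M0 ln0; have phi_on := proj1 phi_basis.
pose g := f - fourier phi f n; pose y := A g.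
have -> : A f - A (fourier phi f n) = y.
  by have [A_lin _] := A_bounded; rewrite /y /g (linear_mapB A_lin).
(* Cutting off below [n] removes the small or zero eigenvalues, so the ordering bounds the symbol by
   its value at [n]. *)
pose m k : R := if (k < n)%N then 0 else (lam k)^-1.
have m_bound k : `|m k| <= `|lam n|^-1.
  rewrite /m; case: ltnP => nk; first by rewrite normr0 invr_ge0.
  have l0 : 0 < `|lam n| by rewrite normr_gt0.
  by rewrite normfV lef_pV2 ?lam_ordered// posrE (lt_le_trans l0)// lam_ordered.
(* The error of the replacement has no coefficients from [n] on, hence is orthogonal to [g]. *)
pose w := adjoint setT A y - diag phi m (T y).
have w_low : fourier phi w n = w.
  apply: (fourier_ext phi_basis) => k; rewrite inner_phi_comb//.
  case: ltnP => // nk; rewrite innerBr (inner_phi_diag phi_basis m_bound).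
  rewrite inner_phi_eigen// mulrA -of_realM /m ltnNge nk /= mulVf.
    by rewrite of_real1 mul1r subrr.
  by rewrite -normr_gt0 (lt_le_trans _ (lam_ordered nk))// normr_gt0.
have wg : inner w g = 0 by rewrite -w_low inner_comb_residual.
have yy : inner (diag phi m (T y)) g = rl (rnorm y ^+ 2).
  apply/eqP; rewrite -innerxx eq_sym -subr_eq0 -(inner_adjoint phi_basis A_bounded).
  by rewrite -innerBl wg.
have := cauchy_schwarz (diag phi m (T y)) g.
rewrite yy rabs_real ger0_norm ?sqr_ge0// expr2 => y_le.
have [->|y0] := eqVneq (rnorm y) 0.
  by rewrite !mulr_ge0 ?rnorm_ge0 ?invr_ge0.
rewrite -(ler_pM2l (x := rnorm y)) ?lt_neqAle ?rnorm_ge0 ?andbT 1?eq_sym//.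
apply: (le_trans y_le); rewrite mulrA ler_pM ?rnorm_ge0//.
  rewrite (le_trans (rnorm_diag phi_basis m_bound _))// mulrCA ler_wpM2l ?invr_ge0//.
  by rewrite mulrC (le_trans (TM y))// mulrC.
exact: rnorm_residual.
Qed.

End SmoothingOperator.

(** * The pseudo-inverse as a diagonal operator *)

Section Dagger.
Hypothesis lam_ordered : forall i j, (i <= j)%N -> `|lam i| <= `|lam j|.

(** The convention that [0^-1] is 0 drops the kernel terms, as in [dagger_term]. *)
Let mu k : R := (lam k)^-1.

(** By the ordering, the first nonzero eigenvalue has the least modulus among the nonzero ones. *)
Lemma inv_eigenvalues_bounded : exists C : R, forall k, `|mu k| <= C.
Proof.
have [lam_nz|lam_z] := pselect (exists k, lam k != 0); last first.
  exists 0 => k; rewrite /mu (_ : lam k = 0) ?invr0 ?normr0//.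
  by apply/eqP/negPn/negP => lk; apply: lam_z; exists k.
case: (ex_minnP lam_nz) => i li i_min; exists `|lam i|^-1 => k; rewrite /mu.
have [->|lk] := eqVneq (lam k) 0; first by rewrite invr0 normr0 invr_ge0.
by rewrite normfV lef_pV2 ?posrE ?normr_gt0 ?lam_ordered ?i_min.
Qed.

Lemma dagger_series f :
  series (dagger_term phi lam f) = comb phi (fun k => rl (mu k) * inner (phi k) f).
Proof.
congr series; apply/funext => k; rewrite /dagger_term /mu.
by case: eqVneq => //= ->; rewrite invr0 of_real0 mul0r scale0r.
Qed.

Lemma daggerE : dagger phi lam = diag phi mu.
Proof. by apply/funext => f; rewrite /dagger dagger_series. Qed.

(** The symbol of [L] after the pseudo-inverse: 0 on zero eigenvalues and 1 elsewhere. *)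
Let nu k : R := mu k * lam k.

Let nu_bound k : `|nu k| <= 1.
Proof.
rewrite /nu /mu; have [->|lk] := eqVneq (lam k) 0; first by rewrite mulr0 normr0.
by rewrite mulVf// normr1.
Qed.

(** Since [D] is the adjoint domain, it suffices to represent the functional sending [u] to
    [inner (dagger phi lam f) (L u)]; the vector [diag phi nu f] does so, as both diagonal operators
    can be moved onto the other argument. *)
Lemma dagger_dom f : D (dagger phi lam f).
Proof.
have [C mu_bound] := inv_eigenvalues_bounded.
have [_ _ <- _] := L_self_adjoint; exists (diag phi nu f) => u Du.
rewrite daggerE (diag_symmetric phi_basis mu_bound).
rewrite (diag_symmetric phi_basis nu_bound); congr inner.
apply: (fourier_ext phi_basis) => k.
rewrite (inner_phi_diag phi_basis mu_bound) (inner_phi_diag phi_basis nu_bound).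
by rewrite inner_phi_eigen// mulrA -of_realM.
Qed.

Lemma inner_phi_L_dagger k f :
  inner (phi k) (L (dagger phi lam f)) = rl (nu k) * inner (phi k) f.
Proof.
have [C mu_bound] := inv_eigenvalues_bounded.
rewrite inner_phi_eigen; last exact: dagger_dom.
by rewrite daggerE (inner_phi_diag phi_basis mu_bound) mulrA -of_realM [lam k * _]mulrC.
Qed.

Lemma L_dagger f : L (dagger phi lam f) = diag phi nu f.
Proof.
apply: (fourier_ext phi_basis) => k.
by rewrite inner_phi_L_dagger (inner_phi_diag phi_basis nu_bound).
Qed.

Lemma rnorm_L_dagger f : rnorm (L (dagger phi lam f)) <= rnorm f.
Proof. by rewrite L_dagger (le_trans (rnorm_diag phi_basis nu_bound _))// mul1r. Qed.

Lemma dagger_phi k : dagger phi lam (phi k) = rl (lam k)^-1 *: phi k.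
Proof.
have [C mu_bound] := inv_eigenvalues_bounded.
rewrite daggerE; apply: (fourier_ext phi_basis) => j.
rewrite (inner_phi_diag phi_basis mu_bound) innerZr (proj1 phi_basis) /mu.
by have [->|] := eqVneq j k; rewrite ?mulr0.
Qed.

Lemma dagger_bounded : bounded_operator (dagger phi lam).
Proof.
have [C mu_bound] := inv_eigenvalues_bounded.
by rewrite daggerE; exact: (diag_bounded phi_basis mu_bound).
Qed.

Lemma dagger_symmetric x y :
  inner (dagger phi lam x) y = inner x (dagger phi lam y).
Proof.
have [C mu_bound] := inv_eigenvalues_bounded.
by rewrite daggerE; exact: (diag_symmetric phi_basis mu_bound).
Qed.

Lemma adjoint_dagger : adjoint setT (dagger phi lam) = dagger phi lam.
Proof.
apply/funext => y; apply: (fourier_ext phi_basis) => k.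
rewrite inner_conj (inner_adjoint phi_basis dagger_bounded) -dagger_symmetric.
by rewrite -inner_conj.
Qed.

Lemma dagger_self_adjoint : self_adjoint setT (dagger phi lam).
Proof.
split=> [||| y _].
- by move=> O [x Ox] _; exists x.
- by split=> // a x y _ _; split=> //; have [-> _] := dagger_bounded.
- apply/seteqP; split=> // y _; exists (dagger phi lam y) => x _.
  by rewrite dagger_symmetric.
- by rewrite adjoint_dagger.
Qed.

Lemma dagger_compact : compactly_embedded D L ->
  compact_operator setT (@rnorm R s H) (dagger phi lam).
Proof.
move=> D_compact B _ [M BM].
have [C C0 dag_bound] := bounded_operator_nonneg dagger_bounded.
(* The image of [B] is viewed as its own image under the embedding of [D], leaving a bound in the
   graph norm. *)
rewrite -[X in precompact X]image_id; apply: D_compact.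
  by move=> _ [f _ <-]; exact: dagger_dom.
exists (Num.sqrt ((C * M) ^+ 2 + M ^+ 2)) => _ [f Bf <-].
have fM := BM f Bf; have M0 := le_trans (rnorm_ge0 f) fM.
apply/ler_wsqrtr/lerD; rewrite ler_pXn2r ?nnegrE ?rnorm_ge0 ?mulr_ge0//.
  by rewrite (le_trans (dag_bound f))// ler_wpM2l.
exact: le_trans (rnorm_L_dagger f) fM.
Qed.

End Dagger.

End SelfAdjoint.

(* The basis and the eigenvalues are indexed from 0: phi k and lam k are the
   (k+1)-st eigenfunction and eigenvalue, so span {phi k | k < n} is the span of
   the first n eigenfunctions and lam n is the (n+1)-st eigenvalue. *)
Theorem theorem9 (R : realType) (s : scalar_kind) (H : hilbertType R s)
    (H_infinite : infinite_dimensional H) (H_separable : separable_space H)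
    (D : set H) (L : H -> H)
    (L_self_adjoint : self_adjoint D L)
    (D_compact : compactly_embedded D L)
    (phi : nat -> H) (lam : nat -> R)
    (phi_basis : orthonormal_basis phi)
    (phi_eigen : forall k, D (phi k) /\ L (phi k) = of_real s (lam k) *: phi k)
    (lam_ordered : forall i j, (i <= j)%N -> `|lam i| <= `|lam j|)
    (lam_infty : (fun k => `|lam k|) @ \oo --> +oo) :
  let P (n : nat) : H -> H :=
    orth_proj (lin_span [set phi k | k in [set k | (k < n)%N]]) in
  (forall (H' : hilbertType R s) (A : H -> H'),
     bounded_operator A ->
     range (adjoint setT A) `<=` D ->
     bounded_operator (L \o adjoint setT A) /\
     (forall n, (1 <= n)%N -> lam n != 0 ->
        (opnorm (fun f => (A f - A (P n f))%R) <=
           (`|lam n|^-1)%R%:E * opnorm (L \o adjoint setT A))%E)) /\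
  [/\ forall f, cvgn (series (dagger_term phi lam f)),
      bounded_operator (dagger phi lam),
      compact_operator setT (@rnorm R s H) (dagger phi lam),
      self_adjoint setT (dagger phi lam) &
      range (adjoint setT (dagger phi lam)) `<=` D /\
      (forall n, (1 <= n)%N -> lam n != 0 ->
         opnorm (fun f => dagger phi lam f - dagger phi lam (P n f)) =
           ((`|lam n|^-1)%R%:E * opnorm (L \o adjoint setT (dagger phi lam)))%E)].
Proof.
move=> P; have phi_on := proj1 phi_basis.
have PE n f : P n f = fourier phi f n by exact: orth_proj_span.
(* Proved for general [A] first, since it also gives one half of the equality for the
   pseudo-inverse. *)
have upper (H' : hilbertType R s) (A : H -> H') : bounded_operator A ->
    range (adjoint setT A) `<=` D ->
    bounded_operator (L \o adjoint setT A) /\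
    (forall n, (1 <= n)%N -> lam n != 0 ->
      (opnorm (fun f => (A f - A (P n f))%R) <=
         (`|lam n|^-1)%R%:E * opnorm (L \o adjoint setT A))%E).
  move=> A_bounded A_range.
  have T_bounded :=
    adjoint_smoothing_bounded L_self_adjoint phi_basis phi_eigen A_bounded A_range.
  split=> // n _ ln; have [M [M0 -> TM]] := opnorm_bounded T_bounded.
  rewrite -EFinM; apply: opnorm_le => f f1; rewrite PE.
  apply: le_trans (truncation_le L_self_adjoint phi_basis phi_eigen
    A_bounded A_range lam_ordered _ TM M0 ln) _.
  by rewrite ler_piMr// mulr_ge0// invr_ge0.
split=> //.
have dag_bounded := dagger_bounded phi_basis lam_ordered.
have dag_adjoint := adjoint_dagger phi_basis lam_ordered.
have dag_range : range (adjoint setT (dagger phi lam)) `<=` D.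
  rewrite dag_adjoint => _ [f _ <-].
  exact: (dagger_dom L_self_adjoint phi_basis phi_eigen lam_ordered).
split=> //.
- move=> f; have [C mu_bound] := inv_eigenvalues_bounded lam_ordered.
  by rewrite dagger_series; exact: (diag_cvg phi_basis mu_bound).
- exact: (dagger_compact L_self_adjoint phi_basis phi_eigen lam_ordered D_compact).
- exact: (dagger_self_adjoint phi_basis lam_ordered).
split=> // n n1 ln; apply/eqP; rewrite eq_le (proj2 (upper _ _ dag_bounded dag_range))//=.
(* The reverse inequality passes through the inverse modulus of [lam n]: [L] after the
   pseudo-inverse has norm at most 1, and [phi n] shows that the truncation error is at least this
   value. *)
apply: (@le_trans _ _ (`|lam n|^-1)%:E).
  rewrite -[leRHS]mule1 lee_pmul2l ?lte_fin ?invr_gt0 ?normr_gt0// dag_adjoint.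
  apply: opnorm_le => f f1; apply: le_trans f1.
  exact: (rnorm_L_dagger L_self_adjoint phi_basis phi_eigen lam_ordered).
(* The range of [P n] is spanned by the indices below [n], so [phi n] is the first basis vector it
   kills. *)
have Pn : P n (phi n) = 0.
  rewrite PE /fourier (@eq_comb _ _ _ _ _ (fun=> 0)) => [|k kn].
    by rewrite comb_eq0.
  by rewrite phi_on ltn_eqF.
have dag0 := linear_map0 (proj1 dag_bounded).
set T := (X in (_ <= opnorm X)%E).
have := @opnorm_ge _ _ _ _ T (phi n).
rewrite /T Pn dag0 subr0 (dagger_phi phi_basis lam_ordered) rnormZ rabs_real.
by rewrite rnorm_phi// mulr1 normfV; exact.
Qed.
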